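(* Let $p\geq 2$ and suppose $\{\boldsymbol J_N\}_{N \geq 1}$ is a sequence of symmetric $p$-tensors with zero diagonals ($\boldsymbol J_N$ having all indices in $\{1,\ldots,N\}$) such that the following two conditions hold: (1) $\sup_{N\geq 1} \|\boldsymbol D_{\boldsymbol J_N} \| <\infty$, where $\boldsymbol D_{\boldsymbol J_N}$ is the co-degree matrix of $\boldsymbol J_N$; (2) $\liminf_{N\rightarrow \infty} \frac{1}{N} \sum_{1 \leq i_1 < i_2 < \cdots < i_p \leq N} J_{i_1 i_2 \ldots i_p}^2> 0$. Then the maximum pseudo-likelihood (MPL) estimate $\hat{\beta}_N(\boldsymbol X)$, based on a single sample $\boldsymbol X\sim \mathbb{P}_\beta$ from the $p$-tensor Ising model with interaction tensor $\boldsymbol J_N$, is $\sqrt N$-consistent for all $\beta > 0$.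
   Context: Let $\mathcal{C}_N=\{-1,1\}^N$. A $p$-tensor is $\boldsymbol J_N=((J_{i_1\ldots i_p}))_{1\leq i_1,\ldots,i_p\leq N}$ with real entries; symmetric means entries are invariant under permutations of the indices; zero diagonals means $J_{i_1\ldots i_p}=0$ whenever two of the indices coincide. The $p$-tensor Ising model with interaction tensor $\boldsymbol J_N$ and parameter $\beta\ge0$ is the probability distribution on $\mathcal{C}_N$ given by $\mathbb{P}_{\beta}(\boldsymbol x)=\frac{1}{2^N Z_N(\beta)}e^{\beta H_N(\boldsymbol x)}$, where $H_N(\boldsymbol x)=\sum_{1\leq i_1,\ldots,i_p\leq N}J_{i_1\ldots i_p}x_{i_1}\cdots x_{i_p}$ and $Z_N(\beta)=\frac{1}{2^N}\sum_{\boldsymbol x\in\mathcal{C}_N}e^{\beta H_N(\boldsymbol x)}$. The co-degree matrix is $\boldsymbol D_{\boldsymbol J_N}=((d_{\boldsymbol J_N}(i_1,i_2)))_{1\le i_1,i_2\le N}$ with $d_{\boldsymbol J_N}(i_1,i_2)=\frac{1}{(p-2)!}\sum_{1\leq i_3,\ldots,i_p\leq N}|J_{i_1i_2i_3\ldots i_p}|$. For a matrix $A$, $\|A\|$ is the Euclidean operator norm. With $m_i(\boldsymbol x)=\sum_{1\leq i_2,\ldots,i_p\leq N}J_{i i_2\ldots i_p}x_{i_2}\cdots x_{i_p}$, the MPL estimate is $$\hat\beta_N(\boldsymbol X)=\inf\Big\{b\geq 0: H_N(\boldsymbol X)=\sum_{i=1}^N m_i(\boldsymbol X)\tanh\big(p\,b\,m_i(\boldsymbol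 X)\big)\Big\},$$ with $\inf\emptyset=+\infty$. $\sqrt N$-consistency at $\beta$ means: for every $\delta>0$ there is $M=M(\delta,\beta)>0$ such that $\mathbb{P}_\beta(\sqrt N|\hat\beta_N(\boldsymbol X)-\beta|\le M)>1-\delta$ for all $N$ large enough. *)

(* Defs.v *)
From HB Require Import structures.
From mathcomp Require Import all_boot all_order all_algebra.
From mathcomp Require Import all_classical all_reals all_analysis.
Import Order.TTheory GRing.Theory Num.Theory.

Set Implicit Arguments.
Unset Strict Implicit.
Unset Printing Implicit Defensive.

Local Open Scope classical_set_scope.
Local Open Scope ring_scope.

(* The entry J_{i_1 ... i_p} is J [tuple i_1; ...; i_p]; the indices 1..N are
   represented by 'I_N, i.e. 0..N-1. *)
Definition tensor (R : realType) (p N : nat) := p.-tuple 'I_N -> R.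

Definition symmetric_tensor (R : realType) (p N : nat) (J : tensor R p N) :=
  forall s t : p.-tuple 'I_N, perm_eq s t -> J s = J t.

Definition zero_diagonals (R : realType) (p N : nat) (J : tensor R p N) :=
  forall t : p.-tuple 'I_N, ~~ uniq t -> J t = 0.

(* For 2 <= p the sum runs over the tuples (i1, i2, i_3, ..., i_p) whose first
   two indices are the given i1, i2. *)
Definition codegree_mx (R : realType) (p N : nat) (J : tensor R p N) :
    'M[R]_N :=
  \matrix_(i1, i2) (((p - 2)`!)%:R^-1 *
    \sum_(t : p.-tuple 'I_N | take 2 t == [:: i1; i2]) `|J t|).

Definition euclidean_norm (R : realType) (N : nat) (v : 'cV[R]_N) : R :=
  Num.sqrt (\sum_i v i 0 ^+ 2).

(* The supremum is taken in \bar R; the library's norm on matrices is the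
   maximum of the entries, hence the explicit Euclidean norm. *)
Definition opnorm (R : realType) (N : nat) (A : 'M[R]_N) : \bar R :=
  ereal_sup [set (euclidean_norm (A *m v))%:E |
    v in [set v : 'cV[R]_N | euclidean_norm v <= 1]].

(* {-1, 1}^N, each sign (-1) ^+ b being encoded by the boolean b *)
Definition cube (N : nat) := {ffun 'I_N -> bool}.

Definition spin (R : realType) (N : nat) (x : cube N) (i : 'I_N) : R :=
  (-1) ^+ x i.

Definition hamiltonian (R : realType) (p N : nat) (J : tensor R p N)
    (x : cube N) : R :=
  \sum_(t : p.-tuple 'I_N) J t * \prod_(j <- t) spin R x j.

Definition partition_function (R : realType) (p N : nat) (J : tensor R p N)
    (beta : R) : R :=
  (2 ^+ N)^-1 * \sum_(x : cube N) expR (beta * hamiltonian J x).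

Definition ising_pmf (R : realType) (p N : nat) (J : tensor R p N) (beta : R)
    (x : cube N) : R :=
  (2 ^+ N * partition_function J beta)^-1 * expR (beta * hamiltonian J x).

Definition ising_prob (R : realType) (p N : nat) (J : tensor R p N) (beta : R)
    (E : pred (cube N)) : R :=
  \sum_(x : cube N | E x) ising_pmf J beta x.

(* m_i(x): the sum runs over the tuples (i, i_2, ..., i_p), and the product over
   i_2, ..., i_p only. *)
Definition local_field (R : realType) (p N : nat) (J : tensor R p N)
    (x : cube N) (i : 'I_N) : R :=
  \sum_(t : p.-tuple 'I_N | take 1 t == [:: i])
    J t * \prod_(j <- behead t) spin R x j.

Definition tanh (R : realType) (x : R) : R :=
  (expR x - expR (- x)) / (expR x + expR (- x)).

(* ereal_inf set0 = +oo, as required *)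
Definition mpl_estimate (R : realType) (p N : nat) (J : tensor R p N)
    (x : cube N) : \bar R :=
  ereal_inf [set b%:E | b in [set b : R | 0 <= b /\
    hamiltonian J x =
      \sum_i local_field J x i * tanh (p%:R * b * local_field J x i)]].

Definition mpl_sqrtN_consistent (R : realType) (p : nat)
    (J : forall N : nat, tensor R p N) (beta : R) : Prop :=
  forall delta : R, 0 < delta -> exists M : R, 0 < M /\
    \forall N \near \oo,
      1 - delta < ising_prob (J N) beta
        (fun x => (Num.sqrt N%:R)%:E * `|mpl_estimate (J N) x - beta%:E|
                    <= M%:E)%E.

(* Main.v *)
Require Import Defs.
From mathcomp Require Import all_boot all_order all_algebra.
From mathcomp Require Import all_classical all_reals all_analysis.
From mathcomp Require Import fingroup perm ring lra.
Import Order.TTheory GRing.Theory Num.Theory.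
Import numFieldNormedType.Exports.

Set Implicit Arguments.
Unset Strict Implicit.
Unset Printing Implicit Defensive.

Local Open Scope classical_set_scope.
Local Open Scope ring_scope.

(** Write m_i for the local fields, R_i for the sum of the |J_t| over the
    tuples t starting with i, and
      S(b) = H - sum_i m_i tanh (p b m_i)
    for the score, whose zeros are the candidates of the estimator. The law at
    inverse temperature b is denoted P_b, its mean E_b, and Z(b) is the sum of
    the weights exp (b H). Bounding the norm of the co-degree matrix, tested on
    the constant vector and on the basis vectors, bounds sum_i R_i^2 by a
    multiple of N and all entries of J by a constant, and |m_i| <= R_i. Two
    facts give the theorem: S(beta) is of order sqrt N, and S decreases at a
    rate of order N around beta, so that its zero lies within O(1 / sqrt N) of
    beta.

    Size of the score. Conditionally on the other spins, x_i has mean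
    tanh (p b m_i). Pairing each configuration with the one where x_i is
    flipped turns this into the identity
      E_b [(x_i - tanh (p b m_i)) g] = 1/2 E_b [(x_i - tanh (p b m_i)) D_i g],
    where D_i g is the change of g under the flip (mean_residual). As S(b) is
    sum_i m_i (x_i - tanh (p b m_i)) and m_i does not depend on x_i, the second
    moment of S(b) is governed by the products m_i D_i S(b). The function
    u tanh u is Lipschitz, so |D_i S(b)| is at most a multiple of R_i, hence
    E_b [S(b)^2] = O(sum_i R_i^2) = O(N) (mean_score_sqr).

    Slope of the score. The slope is at least of order N on configurations
    where H >= c N: there sum_i |m_i| >= c N while sum_i m_i^2 = O(N), so the
    indices with |m_i| below a large constant carry half of the bound c N, and
    for them the increments of m_i tanh (p b m_i) in b are at least
    proportional to m_i^2 (score_decrease). It remains to see that H >= c N with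
    probability tending to one. By Jensen's inequality Z(b + a) / Z(b) is at
    least exp (a E_b H); taking b = beta / 2, the event H < c N has P_beta
    probability at most exp (beta c N - (beta / 2) E_(beta / 2) H)
    (ising_prob_hamiltonian_lt). This is exponentially small once E_b H is at
    least a constant times N for the fixed b = beta / 2.

    Mean energy. The flip identity gives E_b H = sum_i E_b [m_i tanh (p b m_i)],
    so it is enough to bound sum_i E_b |m_i| from below
    (sum_mean_normr_le). Differencing m_i successively along the other p - 1
    indices of a tuple t isolates the coefficient of the corresponding Walsh
    monomial, hence leaves at least |J_t|, and each difference costs at most
    the factor 1 + exp (2 p b R_j) in mean absolute value, because flipping one
    spin changes the weights by a bounded factor. Therefore
    E_b |m_i| >= |J_t| / C when all R_j along t are bounded by A
    (tensor_le_mean), and summing J_t^2 <= C |J_t| E_b |m_i| over such tuples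
    gives sum_i E_b |m_i| >= (sum over them of J_t^2) / (A C). By Markov's
    inequality the tuples meeting an index with R_j > A carry only O(N / A) of
    the sum of the J_t^2, which is at least a multiple of N (sum_sqr_le). *)

(** * Elementary bounds on the hyperbolic tangent *)

Section Tanh.
Variable R : realType.
Implicit Types a b u v x : R.

Lemma tanhE x : tanh x = 1 - 2 / (expR (2 * x) + 1).
Proof.
have e0 : 0 < expR x by exact: expR_gt0.
have e1 : 0 < expR x ^+ 2 + 1 by rewrite ltr_wpDl// sqr_ge0.
have -> : expR (2 * x) = expR x ^+ 2 by rewrite expRM_natl.
rewrite /tanh expRN.
have : expR x ^+ 2 + 1 != 0 by rewrite gt_eqF.
have : expR x != 0 by rewrite gt_eqF.
by move: (expR x) => e he h; field; rewrite h he.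
Qed.

Lemma tanhN x : tanh (- x) = - tanh x.
Proof. by rewrite /tanh opprK -mulNr opprB [in X in _ / X]addrC. Qed.

Lemma tanh0 : tanh (0 : R) = 0.
Proof. by rewrite /tanh oppr0 subrr mul0r. Qed.

Lemma tanhB u v : tanh u - tanh v =
  2 * (expR (2 * u) - expR (2 * v)) / ((expR (2 * u) + 1) * (expR (2 * v) + 1)).
Proof.
rewrite !tanhE.
have : expR (2 * u) + 1 != 0 by rewrite gt_eqF// ltr_wpDl// expR_ge0.
have : expR (2 * v) + 1 != 0 by rewrite gt_eqF// ltr_wpDl// expR_ge0.
move: (expR _) (expR _) => e f h1 h2; field; by rewrite h1 h2.
Qed.

Lemma ler_tanh u v : u <= v -> tanh u <= tanh v.
Proof.
move=> uv; rewrite -subr_ge0 tanhB; apply: divr_ge0.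
  by rewrite mulr_ge0// subr_ge0 ler_expR ler_wpM2l.
by rewrite mulr_ge0// addr_ge0// expR_ge0.
Qed.

Lemma tanh_ge0 x : 0 <= x -> 0 <= tanh x.
Proof. by rewrite -{2}tanh0; exact: ler_tanh. Qed.

Lemma normr_tanh x : `|tanh x| = tanh `|x|.
Proof.
have [x0|x0] := leP 0 x; first by rewrite !ger0_norm// tanh_ge0.
rewrite (ltr0_norm x0) tanhN ler0_norm//.
by rewrite -oppr_ge0 -tanhN tanh_ge0// oppr_ge0 ltW.
Qed.

Lemma normr_tanh_le1 x : `|tanh x| <= 1.
Proof. by rewrite normr_tanh tanhE gerBl divr_ge0// addr_ge0// expR_ge0. Qed.

Lemma mulr_tanh a x : 0 <= a -> x * tanh (a * x) = `|x| * tanh (a * `|x|).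
Proof.
move=> a0; have [x0|x0] := leP 0 x; first by rewrite ger0_norm.
by rewrite ltr0_norm// mulrN tanhN mulrNN.
Qed.

(** A mean value inequality in which the derivative 1 / cosh^2 is bounded
    below on the interval from 0 to B by exp (- 2 B). *)
Lemma tanhB_ge a b B : 0 <= a -> a <= b -> b <= B ->
  (b - a) * expR (- (2 * B)) <= tanh b - tanh a.
Proof.
move=> a0 ab bB; rewrite tanhB.
have ea : 1 <= expR (2 * a) by rewrite -[X in X <= _]expR0 ler_expR mulr_ge0.
have eb : 1 <= expR (2 * b).
  by rewrite -[X in X <= _]expR0 ler_expR mulr_ge0// (le_trans a0).
have -> : expR (2 * b) - expR (2 * a) =
    expR (2 * a) * (expR (2 * (b - a)) - 1).
  by rewrite mulrBr mulr1 -expRD; congr (expR _ - _); ring.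
have h : 2 * (b - a) <= expR (2 * (b - a)) - 1.
  by rewrite lerBrDl expR_ge1Dx.
rewrite ler_pdivlMr; last by rewrite mulr_gt0//; lra.
apply: (@le_trans _ _ ((b - a) * expR (- (2 * B)) *
   ((2 * expR (2 * b)) * (2 * expR (2 * a))))).
  apply: ler_wpM2l; first by rewrite mulr_ge0 ?expR_ge0// subr_ge0.
  by apply: ler_pM; lra.
have hB : expR (- (2 * B)) * expR (2 * b) <= 1.
  by rewrite -expRD -[X in _ <= X]expR0 ler_expR; lra.
have -> : (b - a) * expR (- (2 * B)) * (2 * expR (2 * b) * (2 * expR (2 * a)))
  = 2 * (expR (2 * a) * ((2 * (b - a)) * (expR (- (2 * B)) * expR (2 * b)))).
  by ring.
rewrite ler_wpM2l// ler_wpM2l ?expR_ge0//.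
apply: le_trans h; rewrite ler_piMr// mulr_ge0// subr_ge0//.
Qed.

(** The derivative tanh u + u / cosh^2 u is bounded. The second term is the
    delicate one: v (tanh u - tanh v) stays of order u - v for large v because
    the increments of tanh decay like exp (- 2 v). *)
Lemma mulr_tanh_lipschitz1 u v : 0 <= v -> v <= u ->
  `|u * tanh u - v * tanh v| <= 3 * (u - v).
Proof.
move=> v0 vu.
have -> : u * tanh u - v * tanh v = (u - v) * tanh u + v * (tanh u - tanh v).
  by ring.
have tu : tanh u <= 1.
  by apply: le_trans (normr_tanh_le1 u); rewrite ler_norm.
have u0 : 0 <= u by exact: le_trans vu.
have tu0 := tanh_ge0 u0.
rewrite ger0_norm; last first.
  by rewrite addr_ge0// mulr_ge0// subr_ge0// ler_tanh.
have h1 : (u - v) * tanh u <= u - v by rewrite ler_piMr// subr_ge0.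
suff : v * (tanh u - tanh v) <= 2 * (u - v) by lra.
rewrite tanhB.
have e1 : 0 < expR (2 * v) by exact: expR_gt0.
have e2 : 0 < expR (2 * u) by exact: expR_gt0.
rewrite mulrA ler_pdivrMr; last by rewrite mulr_gt0//; lra.
have h2 : 2 * v <= expR (2 * v) + 1.
  by have := expR_ge1Dx (2 * v); lra.
have h3 : expR (2 * u) - expR (2 * v) <= 2 * (u - v) * (expR (2 * u) + 1).
  have -> : expR (2 * v) = expR (2 * u) * expR (- (2 * (u - v))).
    by rewrite -expRD; congr expR; ring.
  have := expR_ge1Dx (- (2 * (u - v))) => h.
  apply: (@le_trans _ _ (2 * (u - v) * expR (2 * u))); last first.
    by apply: ler_wpM2l; [rewrite mulr_ge0// subr_ge0|lra].
  rewrite -[X in X - _]mulr1 -mulrBr mulrC; apply: ler_wpM2r; [exact: ltW|lra].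
have h4 : 0 <= expR (2 * u) - expR (2 * v).
  by rewrite subr_ge0 ler_expR; lra.
have -> : v * (2 * (expR (2 * u) - expR (2 * v))) =
  (2 * v) * (expR (2 * u) - expR (2 * v)) by ring.
have -> : 2 * (u - v) * ((expR (2 * u) + 1) * (expR (2 * v) + 1)) =
  (expR (2 * v) + 1) * (2 * (u - v) * (expR (2 * u) + 1)) by ring.
by apply: ler_pM => //; rewrite mulr_ge0.
Qed.

(** The constant does not depend on the scale a, since
    u tanh (a u) is a^-1 w tanh w for w = a u. *)
Lemma mulr_tanh_lipschitz a u v : 0 < a ->
  `|u * tanh (a * u) - v * tanh (a * v)| <= 3 * `|u - v|.
Proof.
move=> a0; have a0' := ltW a0; rewrite (mulr_tanh u)// (mulr_tanh v)//.
apply: (@le_trans _ _ (3 * `| `|u| - `|v| |)); last first.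
  by rewrite ler_wpM2l// ler_dist_dist.
wlog uv : u v / `|v| <= `|u|.
  move=> H; have [/H//|/ltW/H] := leP `|v| `|u|.
  by rewrite distrC [X in _ -> _ <= 3 * X]distrC.
rewrite (@ger0_norm _ (`|u| - _)) ?subr_ge0//.
rewrite -(ler_pM2l a0) -[X in X * `|_|](gtr0_norm a0) -normrM mulrBr !(mulrA a).
have -> : a * 3 * (`|u| - `|v|) = 3 * (a * `|u| - a * `|v|) by ring.
by apply: mulr_tanh_lipschitz1; rewrite ?mulr_ge0 ?ler_wpM2l.
Qed.

(** With u = p b m_i, exp (2 u) is the ratio of the conditional probabilities
    (1 + tanh u) / 2 and (1 - tanh u) / 2 of the two values of x_i. *)
Lemma expR_tanh u : expR (2 * u) * (1 - tanh u) = 1 + tanh u.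
Proof.
rewrite tanhE; have : expR (2 * u) + 1 != 0.
  by rewrite gt_eqF// ltr_wpDl// expR_ge0.
by move: (expR _) => e h; field.
Qed.

Lemma tanh_gt0 u : 0 < u -> 0 < tanh u.
Proof.
move=> u0; have := tanhB_ge (lexx 0) (ltW u0) (lexx u).
rewrite tanh0 !subr0; apply: lt_le_trans.
by rewrite mulr_gt0// expR_gt0.
Qed.

(** Compares |v| with v tanh (a v), which is only quadratic near the
    origin: values below e are paid for by the additive term. *)
Lemma normr_le_mulr_tanh a e v : 0 < a -> 0 < e ->
  `|v| <= e + v * tanh (a * v) / tanh (a * e).
Proof.
move=> a0 e0; have a0' := ltW a0; rewrite mulr_tanh//.
have t0 : 0 < tanh (a * e) by rewrite tanh_gt0// mulr_gt0.
have [ve|/ltW ev] := leP `|v| e.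
  rewrite -[leLHS]addr0; apply: lerD => //; apply: divr_ge0; last exact: ltW.
  by rewrite mulr_ge0// tanh_ge0// mulr_ge0.
rewrite -[leLHS]add0r; apply: lerD; first exact: ltW.
by rewrite ler_pdivlMr//; apply: ler_wpM2l => //; rewrite ler_tanh// ler_wpM2l.
Qed.

(** The increment is at least a multiple of v ^+ 2 as long as |v| <= A. The
    right-hand quantity is linear in |v| and v ^+ 2, hence can be summed when
    only the sums of |v| and v ^+ 2 are known; it is nonpositive for |v| > A,
    and below A it follows from v ^+ 2 >= 2 l |v| - l ^+ 2. Optimizing over l
    replaces an application of the Cauchy-Schwarz inequality. *)
Lemma mulr_tanhB_ge a a' B A l v : 0 <= a -> a <= a' -> a' <= B ->
  0 < A -> 0 <= l ->
  expR (- (2 * (B * A))) * (a' - a) * (2 * l * (`|v| - v ^+ 2 / A) - l ^+ 2) <=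
  v * tanh (a' * v) - v * tanh (a * v).
Proof.
move=> a0 aa' a'B A0 l0; have a'0 : 0 <= a' by exact: le_trans aa'.
rewrite mulr_tanh// (mulr_tanh v)// -mulrBr.
have -> : v ^+ 2 = `|v| ^+ 2 by rewrite real_normK ?num_real.
have := normr_ge0 v; move: `|v| => {}v v0.
set k := expR _; have k0 : 0 <= k by exact: expR_ge0.
have d0 : 0 <= a' - a by rewrite subr_ge0.
have av : a * v <= a' * v by rewrite ler_wpM2r.
have [vA|Av] := leP v A; last first.
  apply: (@le_trans _ _ 0); last by rewrite mulr_ge0// subr_ge0 ler_tanh.
  apply: mulr_ge0_le0; first by rewrite mulr_ge0.
  rewrite subr_le0; apply: (@le_trans _ _ 0); last exact: sqr_ge0.
  apply: mulr_ge0_le0; first by rewrite mulr_ge0.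
  by rewrite subr_le0 ler_pdivlMr// expr2 ler_wpM2l// ltW.
have avB : a' * v <= B * A by rewrite ler_pM.
have := tanhB_ge (mulr_ge0 a0 v0) av avB.
move=> /(ler_wpM2l v0); apply: le_trans.
have -> : v * ((a' * v - a * v) * expR (- (2 * (B * A)))) =
    k * (a' - a) * v ^+ 2 by rewrite /k; ring.
apply: ler_wpM2l; first by rewrite mulr_ge0.
have h1 : 0 <= v ^+ 2 / A by rewrite divr_ge0 ?sqr_ge0// ltW.
(* below the cutoff, v ^+ 2 >= 2 l v - l ^+ 2 because (v - l) ^+ 2 >= 0 *)
have h2 := sqr_ge0 (v - l).
have h3 : 0 <= 2 * l * (v ^+ 2 / A) by rewrite mulr_ge0// mulr_ge0.
move: (v ^+ 2 / A) h1 h3 => w h1 h3; nra.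
Qed.

Lemma continuous_tanh : continuous (@tanh R).
Proof.
move=> x; have -> : @tanh R = fun x => 1 - 2 / (expR (2 * x) + 1).
  by apply/funext => y; exact: tanhE.
apply: cvgB; first exact: cvg_cst.
apply: cvgM; first exact: cvg_cst.
apply: cvgV; first by rewrite gt_eqF// ltr_wpDl// expR_ge0.
apply: cvgD; last exact: cvg_cst.
apply: (@continuous_comp _ _ _ (fun x => 2 * x) expR);
  last exact: continuous_expR.
apply: cvgM; [exact: cvg_cst|exact: cvg_id].
Qed.

End Tanh.

(** * Flips and Walsh monomials on the cube, and sums over positions *)

Section Cube.
Variables (R : realType) (N : nat).
Implicit Types (x : cube N) (i j : 'I_N) (s l : seq 'I_N) (f g : cube N -> R).

Definition flip i x : cube N := [ffun k => (k == i) (+) x k].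

Lemma flipK i : involutive (flip i).
Proof. by move=> x; apply/ffunP => k; rewrite !ffunE addKb. Qed.

Lemma sum_flip i f : \sum_x f (flip i x) = \sum_x f x.
Proof. by rewrite [RHS](reindex_inj (inv_inj (flipK i))). Qed.

Lemma spin_flip i x k :
  spin R (flip i x) k = (if k == i then -1 else 1) * spin R x k.
Proof. by rewrite /spin ffunE signr_addb; case: eqP; rewrite ?expr1. Qed.

Lemma normr_spin x i : `|spin R x i| = 1.
Proof. by rewrite /spin normr_sign. Qed.

Definition walsh s x : R := \prod_(j <- s) spin R x j.

Lemma normr_walsh s x : `|walsh s x| = 1.
Proof.
by rewrite /walsh normr_prod; apply: big1 => k _; exact: normr_spin.
Qed.

Lemma walsh_flip i s x : uniq s ->
  walsh s (flip i x) = (if i \in s then -1 else 1) * walsh s x.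
Proof.
rewrite /walsh; elim: s => [|k s IH] /=; first by rewrite !big_nil mulr1.
move=> /andP[ks us]; rewrite !big_cons IH// spin_flip in_cons (eq_sym i k).
have [ki|_] /= := eqVneq k i; last by case: ifP => _; ring.
by rewrite -ki (negbTE ks); ring.
Qed.

(** Discrete derivative along the spin i, up to the factor 2 x_i. *)
Definition Dflip i f x : R := f x - f (flip i x).

Lemma Dflip_walsh i s x : uniq s ->
  Dflip i (walsh s) x = (i \in s)%:R * 2 * walsh s x.
Proof. by move=> us; rewrite /Dflip walsh_flip//; case: ifP => _ /=; ring. Qed.

Lemma Dflip_sum (T : finType) (P : pred T) (c : T -> R)
    (F : T -> cube N -> R) i x :
  Dflip i (fun y => \sum_(t | P t) c t * F t y) x =
  \sum_(t | P t) c t * Dflip i (F t) x.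
Proof. by rewrite /Dflip -sumrB; apply: eq_bigr => t _; rewrite mulrBr. Qed.

(** Walsh monomials are common eigenfunctions of the differences: the
    eigenvalue is 2 or 0 according to whether the index occurs in the
    monomial. Iterated differences hence keep only the monomials containing
    all the chosen indices. *)
Lemma foldr_Dflip_walsh (T : finType) (P : pred T) (c : T -> R)
    (w : T -> seq 'I_N) l x : (forall t, P t -> c t != 0 -> uniq (w t)) ->
  foldr Dflip (fun y => \sum_(t | P t) c t * walsh (w t) y) l x =
  \sum_(t | P t) c t * (\prod_(i <- l) ((i \in w t)%:R * 2)) * walsh (w t) x.
Proof.
move=> uw; elim: l x => [|i l IH] x /=.
  by apply: eq_bigr => t _; rewrite big_nil mulr1.
rewrite /Dflip !IH -sumrB; apply: eq_bigr => t Pt; rewrite big_cons.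
have [->|c0] := eqVneq (c t) 0; first by rewrite !mul0r subrr.
rewrite walsh_flip ?uw//; case: ifP => _; rewrite ?mul0r /=; ring.
Qed.

End Cube.

(** Tuples have length at least two, so that positions 0 and 1 exist. *)
Section Positions.
Variables (R : realType) (n N : nat).
Implicit Types (t u : n.+2.-tuple 'I_N) (i j : 'I_N) (k : 'I_n.+2).

Definition tuple_perm (s : 'S_n.+2) t := [tuple tnth t (s k) | k < n.+2].

Lemma perm_tuple_perm s t : perm_eq (tuple_perm s t) t.
Proof. by apply/tuple_permP; exists s. Qed.

Lemma tuple_perm_inj s : injective (tuple_perm s).
Proof.
move=> t u tu; apply/eq_from_tnth => k.
have := congr1 (fun t => tnth t (s^-1%g k)) tu.
by rewrite !tnth_mktuple permKV.
Qed.

(** For a symmetric summand a constraint on the positions of a tuple can be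
    moved to other positions; the next three lemmas are the cases in use. *)
Lemma sum_tuple_perm s (P : pred (n.+2.-tuple 'I_N))
    (G : n.+2.-tuple 'I_N -> R) : (forall t u, perm_eq t u -> G t = G u) ->
  \sum_(t | P (tuple_perm s t)) G t = \sum_(t | P t) G t.
Proof.
move=> Ginv; rewrite [RHS](reindex_inj (@tuple_perm_inj s)).
by apply: eq_bigr => t _; apply: Ginv; rewrite perm_sym perm_tuple_perm.
Qed.

Variable G : n.+2.-tuple 'I_N -> R.
Hypothesis Ginv : forall t u, perm_eq t u -> G t = G u.

Let snd_pos : 'I_n.+2 := lift ord0 ord0.

Lemma sum_position k i :
  \sum_(t | tnth t k == i) G t = \sum_(t | tnth t ord0 == i) G t.
Proof.
rewrite -(sum_tuple_perm (tperm ord0 k) _ Ginv).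
by apply: eq_bigl => t; rewrite tnth_mktuple tpermR.
Qed.

Lemma sum_position2 k i j : k != ord0 ->
  \sum_(t | (tnth t ord0 == i) && (tnth t k == j)) G t =
  \sum_(t | (tnth t ord0 == i) && (tnth t snd_pos == j)) G t.
Proof.
move=> k0; rewrite -(sum_tuple_perm (tperm snd_pos k) _ Ginv).
by apply: eq_bigl => t; rewrite !tnth_mktuple tpermR tpermD.
Qed.

Lemma sum_position2C i j :
  \sum_(t | (tnth t ord0 == i) && (tnth t snd_pos == j)) G t =
  \sum_(t | (tnth t ord0 == j) && (tnth t snd_pos == i)) G t.
Proof.
rewrite -(sum_tuple_perm (tperm ord0 snd_pos) _ Ginv).
by apply: eq_bigl => t; rewrite !tnth_mktuple tpermR tpermL andbC.
Qed.

End Positions.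

(** * Local fields and row sums of a symmetric tensor *)

Section Model.
Variables (R : realType) (n N : nat).
Local Notation p := n.+2.
Implicit Types (t u : p.-tuple 'I_N) (i j : 'I_N) (x : cube N).

Let snd_pos : 'I_p := lift ord0 ord0.

Lemma take1_tuple t i : (take 1 t == [:: i]) = (tnth t ord0 == i).
Proof.
by case/tupleP: t => a t; rewrite /= take0 tnth0 eqseq_cons eqxx andbT.
Qed.

Lemma take2_tuple t i j :
  (take 2 t == [:: i; j]) = (tnth t ord0 == i) && (tnth t snd_pos == j).
Proof.
case/tupleP: t => a t; case/tupleP: t => b t.
by rewrite /= take0 tnth0 tnthS tnth0 !eqseq_cons eqxx andbT.
Qed.

Variable J : tensor R p N.

Definition rowsum i : R := \sum_(t | tnth t ord0 == i) `|J t|.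

(** The co-degree matrix without its factor 1 / (p - 2)!. *)
Definition pairsum i j : R :=
  \sum_(t | (tnth t ord0 == i) && (tnth t snd_pos == j)) `|J t|.

Lemma rowsum_ge0 i : 0 <= rowsum i.
Proof. by apply: sumr_ge0. Qed.

Lemma sum_tuple_head (F : p.-tuple 'I_N -> R) :
  \sum_t F t = \sum_i \sum_(t | tnth t ord0 == i) F t.
Proof. by rewrite (partition_big (fun t => tnth t ord0) xpredT). Qed.

Lemma sum_pairsum i : \sum_j pairsum i j = rowsum i.
Proof. by rewrite /rowsum (partition_big (fun t => tnth t snd_pos) xpredT). Qed.

Lemma le_pairsum t : `|J t| <= pairsum (tnth t ord0) (tnth t snd_pos).
Proof.
rewrite /pairsum (bigD1 t) ?eqxx//= lerDl.
by apply: sumr_ge0.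
Qed.

Lemma local_fieldE x i :
  local_field J x i = \sum_(t | tnth t ord0 == i) J t * walsh R (behead t) x.
Proof. by apply: eq_bigl => t; rewrite take1_tuple. Qed.

Lemma hamiltonian_local_field x :
  hamiltonian J x = \sum_i spin R x i * local_field J x i.
Proof.
rewrite /hamiltonian sum_tuple_head; apply: eq_bigr => i _.
rewrite local_fieldE mulr_sumr; apply: eq_bigr => t.
case/tupleP: t => a t; rewrite tnth0 => /eqP ->.
by rewrite big_cons /walsh /= mulrCA.
Qed.

Lemma normr_local_field x i : `|local_field J x i| <= rowsum i.
Proof.
rewrite local_fieldE; apply: le_trans (ler_norm_sum _ _ _) _.
by apply: ler_sum => t _; rewrite normrM normr_walsh mulr1.
Qed.

Hypothesis Jsym : symmetric_tensor J.
Hypothesis Jdiag : zero_diagonals J.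

Lemma tensor_uniq t : J t != 0 -> uniq t.
Proof. by apply: contraNT => /Jdiag ->. Qed.

Lemma normr_tensor_perm t u : perm_eq t u -> `|J t| = `|J u|.
Proof. by move=> /Jsym ->. Qed.

Lemma pairsumC i j : pairsum i j = pairsum j i.
Proof. exact: (sum_position2C (G := fun t => `|J t|) normr_tensor_perm). Qed.

Lemma mem_tuple_sum t i : uniq t ->
  (i \in t)%:R = \sum_(k < p) (tnth t k == i)%:R :> R.
Proof.
move=> ut; rewrite -count_uniq_mem// -sum1_count big_tuple natr_sum.
by rewrite big_mkcond; apply: eq_bigr => k _ /=; case: eqP.
Qed.

(** Only the tuples containing i contribute, and by symmetry i occurs in each
    of the p positions with the same total, which is the one of position 0. *)
Lemma Dflip_hamiltonian i x : Dflip i (hamiltonian J) x =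
  2 * p%:R * (spin R x i * local_field J x i).
Proof.
have -> : hamiltonian J = fun y => \sum_t J t * walsh R t y by [].
rewrite Dflip_sum.
pose G t := J t * walsh R t x.
have Ginv t u : perm_eq t u -> G t = G u.
  by move=> tu; rewrite /G (Jsym tu) /walsh (perm_big _ tu).
have -> : \sum_t J t * Dflip i (walsh R t) x =
    \sum_t 2 * \sum_(k < p) (tnth t k == i)%:R * G t.
  apply: eq_bigr => t _; have [J0|J0] := eqVneq (J t) 0.
    by rewrite /G J0 !mul0r big1 ?mulr0// => k _; rewrite mulr0.
  rewrite Dflip_walsh ?tensor_uniq// mem_tuple_sum ?tensor_uniq//.
  rewrite -mulr_suml /G; ring.
rewrite -mulr_sumr exchange_big/= -mulrA; congr (_ * _).
have -> : spin R x i * local_field J x i = \sum_(t | tnth t ord0 == i) G t.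
  rewrite local_fieldE mulr_sumr; apply: eq_bigr => t.
  case/tupleP: t => a t; rewrite tnth0 => /eqP ->.
  by rewrite /G /walsh big_cons /= mulrCA.
rewrite (eq_bigr (fun=> \sum_(t | tnth t ord0 == i) G t)) => [|k _].
  by rewrite sumr_const card_ord mulr_natl.
rewrite -(sum_position Ginv k) [RHS]big_mkcond/=.
by apply: eq_bigr => t _; case: eqP => _; rewrite ?mul1r ?mul0r.
Qed.

(** A tuple starting with i and repeating i has coefficient zero. *)
Lemma local_field_flip i x : local_field J (flip i x) i = local_field J x i.
Proof.
rewrite !local_fieldE; apply: eq_bigr => t ti.
have [->|/tensor_uniq] := eqVneq (J t) 0; first by rewrite !mul0r.
case/tupleP: t ti => a t; rewrite tnth0 => /eqP -> /= /andP[it ut].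
by rewrite walsh_flip// (negbTE it) mul1r.
Qed.

(** The index i may occupy any of the p - 1 positions after the first, each
    of them contributing pairsum j i in absolute value. *)
Lemma Dflip_local_field i j x :
  `|Dflip i (local_field J ^~ j) x| <= 2 * n.+1%:R * pairsum j i.
Proof.
have -> : local_field J ^~ j =
    fun y => \sum_(t | tnth t ord0 == j) J t * walsh R (behead t) y.
  by apply/funext => y; rewrite local_fieldE.
rewrite Dflip_sum; apply: le_trans (ler_norm_sum _ _ _) _.
apply: (@le_trans _ _ (\sum_(t | tnth t ord0 == j)
    2 * \sum_(k < p | k != ord0) (tnth t k == i)%:R * `|J t|)).
  apply: ler_sum => t tj.
  have [->|/tensor_uniq] := eqVneq (J t) 0.
    by rewrite mul0r normr0 mulr_ge0// sumr_ge0// => k _; rewrite mulr0.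
  move=> ut; have ub : uniq (behead t) by case/tupleP: t ut {tj} => a t /andP[].
  rewrite normrM Dflip_walsh// normrM normr_walsh mulr1 mulrC -mulr_suml.
  rewrite mulrA ler_wpM2r// ger0_norm ?mulr_ge0// mulrC ler_wpM2l//.
  have [it|] := boolP (i \in behead t); last by rewrite sumr_ge0.
  have [k k0 /eqP tk] : exists2 k : 'I_p, k != ord0 & tnth t k == i.
    case/tupleP: t it {tj ut ub} => a t /= /tnthP[k ->].
    by exists (lift ord0 k); rewrite ?tnthS.
  by rewrite (bigD1 k)//= tk eqxx lerDl sumr_ge0.
rewrite -mulr_sumr -mulrA ler_wpM2l// exchange_big/=.
rewrite (eq_bigr (fun=> pairsum j i)) => [|k k0].
  by rewrite sumr_const cardC1 card_ord mulr_natl.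
rewrite /pairsum.
rewrite -(sum_position2 (G := fun t => `|J t|) normr_tensor_perm _ _ k0).
rewrite [RHS]big_mkcondr/=; apply: eq_bigr => t _.
by case: eqP => _; rewrite ?mul1r ?mul0r.
Qed.

(** Flipping x_i disturbs all the local fields together by an amount
    controlled by i alone; this is where the symmetry of pairsum is used. *)
Lemma sum_Dflip_local_field i x :
  \sum_j `|Dflip i (local_field J ^~ j) x| <= 2 * n.+1%:R * rowsum i.
Proof.
apply: (@le_trans _ _ (\sum_j 2 * n.+1%:R * pairsum j i)).
  by apply: ler_sum => j _; exact: Dflip_local_field.
rewrite -mulr_sumr -sum_pairsum.
by under eq_bigr do rewrite pairsumC.
Qed.

End Model.

(** * The Ising measure, the flip identity and the variance of the score *)

Section Gibbs.
Variables (R : realType) (n N : nat).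
Local Notation p := n.+2.
Variable J : tensor R p N.
Implicit Types (t u : p.-tuple 'I_N) (i j : 'I_N) (x : cube N) (b : R).
Implicit Types (f g : cube N -> R).

Local Notation H := (hamiltonian J).
Local Notation m := (local_field J).

Definition gibbs_sum b : R := \sum_x expR (b * H x).

Lemma gibbs_sum_gt0 b : 0 < gibbs_sum b.
Proof.
rewrite /gibbs_sum (bigD1 [ffun=> false])//= ltr_pwDl ?expR_gt0//.
by apply: sumr_ge0 => x _; exact: expR_ge0.
Qed.

Lemma ising_pmfE b x : ising_pmf J b x = expR (b * H x) / gibbs_sum b.
Proof.
by rewrite /ising_pmf /partition_function mulVKf ?expf_neq0// mulrC.
Qed.

Lemma ising_pmf_ge0 b x : 0 <= ising_pmf J b x.
Proof. by rewrite ising_pmfE divr_ge0 ?expR_ge0// ltW// gibbs_sum_gt0. Qed.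

Lemma sum_ising_pmf b : \sum_x ising_pmf J b x = 1.
Proof.
under eq_bigr do rewrite ising_pmfE.
by rewrite -mulr_suml divff// gt_eqF// gibbs_sum_gt0.
Qed.

Definition ising_mean b f : R := \sum_x ising_pmf J b x * f x.

Lemma ising_mean_le b f g : (forall x, f x <= g x) ->
  ising_mean b f <= ising_mean b g.
Proof.
by move=> fg; apply: ler_sum => x _; rewrite ler_wpM2l ?ising_pmf_ge0.
Qed.

Lemma ising_mean_cst b c : ising_mean b (fun=> c) = c.
Proof. by rewrite /ising_mean -mulr_suml sum_ising_pmf mul1r. Qed.

Lemma ising_meanZ b c f : ising_mean b (fun x => c * f x) = c * ising_mean b f.
Proof.
by rewrite /ising_mean mulr_sumr; apply: eq_bigr => x _; rewrite mulrCA.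
Qed.

Lemma ising_meanD b f g :
  ising_mean b (fun x => f x + g x) = ising_mean b f + ising_mean b g.
Proof. by rewrite -big_split; apply: eq_bigr => x _; rewrite mulrDr. Qed.

Lemma ising_mean_sum b (F : 'I_N -> cube N -> R) :
  ising_mean b (fun x => \sum_i F i x) = \sum_i ising_mean b (F i).
Proof.
by rewrite /ising_mean exchange_big; apply: eq_bigr => x _; rewrite mulr_sumr.
Qed.

Lemma ising_mean_eq b f g : f =1 g -> ising_mean b f = ising_mean b g.
Proof. by move=> fg; apply: eq_bigr => x _; rewrite fg. Qed.

Lemma ising_prob_mean b (E : pred (cube N)) :
  ising_prob J b E = ising_mean b (fun x => (E x)%:R).
Proof.
rewrite /ising_prob big_mkcond; apply: eq_bigr => x _.
by case: (E x); rewrite ?mulr1 ?mulr0.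
Qed.

(** Jensen's inequality for the exponential, applied to the mean of
    exp (c H) under the measure at b. *)
Lemma gibbs_sum_ge b c :
  expR (c * ising_mean b H) * gibbs_sum b <= gibbs_sum (b + c).
Proof.
set mu := ising_mean b H.
have -> : expR (c * mu) * gibbs_sum b =
    gibbs_sum b * ising_mean b (fun x => expR (c * mu) * (1 + c * (H x - mu))).
  rewrite ising_meanZ ising_meanD ising_mean_cst ising_meanZ ising_meanD.
  by rewrite ising_mean_cst subrr mulr0 addr0 mulr1 mulrC.
have -> : gibbs_sum (b + c) =
    gibbs_sum b * ising_mean b (fun x => expR (c * H x)).
  rewrite /ising_mean mulr_sumr; apply: eq_bigr => x _.
  rewrite ising_pmfE mulrDl expRD.
  have : gibbs_sum b != 0 by rewrite gt_eqF// gibbs_sum_gt0.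
  by move: (gibbs_sum b) (expR _) (expR _) => z e f z0; field.
rewrite ler_wpM2l ?(ltW (gibbs_sum_gt0 _))//; apply: ising_mean_le => x.
have -> : c * H x = c * mu + c * (H x - mu) by ring.
by rewrite expRD ler_wpM2l ?expR_ge0// expR_ge1Dx.
Qed.

Hypothesis Jsym : symmetric_tensor J.
Hypothesis Jdiag : zero_diagonals J.

Lemma ising_pmf_flip b i x : ising_pmf J b (flip i x) =
  expR (- (2 * (spin R x i * (p%:R * b * m x i)))) * ising_pmf J b x.
Proof.
rewrite !ising_pmfE mulrA -expRD; congr (expR _ / _).
have := Dflip_hamiltonian Jsym Jdiag i x; rewrite /Dflip => h.
have -> : H (flip i x) = H x - 2 * p%:R * (spin R x i * m x i).
  by rewrite -h subKr.
ring.
Qed.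

Lemma spin_tanh_flip i x (v : R) :
  expR (- (2 * (spin R x i * v))) * (- spin R x i - tanh v) =
  - (spin R x i - tanh v).
Proof.
rewrite /spin; case: (x i); rewrite ?expr1 ?expr0.
  by rewrite mulN1r mulrN !opprK expR_tanh; ring.
have := expR_tanh (- v); rewrite tanhN mulrN opprK mul1r => e.
by rewrite -opprD mulrN e.
Qed.

(** The deviation of a spin from its conditional mean given the others. *)
Definition residual b i x : R := spin R x i - tanh (p%:R * b * m x i).

(** This oddness is equivalent to residuals having conditional mean zero. *)
Lemma residual_flip b i x :
  ising_pmf J b (flip i x) * residual b i (flip i x) =
  - (ising_pmf J b x * residual b i x).
Proof.
rewrite /residual local_field_flip// spin_flip eqxx mulN1r ising_pmf_flip.
by rewrite mulrAC spin_tanh_flip mulNr mulrC.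
Qed.

Lemma normr_residual b i x : `|residual b i x| <= 2.
Proof.
apply: le_trans (ler_normB _ _) _; rewrite normr_spin.
have := normr_tanh_le1 (p%:R * b * m x i); lra.
Qed.

(** Integration by parts for the flip of the spin i: the weighted residual is
    odd under the flip, so only the odd part of g contributes. *)
Lemma mean_residual b i g :
  ising_mean b (fun x => residual b i x * g x) =
  2^-1 * ising_mean b (fun x => residual b i x * Dflip i g x).
Proof.
rewrite /ising_mean.
under [in RHS]eq_bigr do rewrite /Dflip mulrBr mulrBr.
rewrite sumrB; set A := \sum_x _; set B := \sum_x _.
suff -> : B = - A by lra.
rewrite /B -(sum_flip i) /A -sumrN; apply: eq_bigr => x _.
by rewrite flipK !mulrA residual_flip mulNr.
Qed.

(** Up to a factor p, the derivative in b of the log-pseudo-likelihood. *)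
Definition score b x : R := H x - \sum_i m x i * tanh (p%:R * b * m x i).

Lemma scoreE b x : score b x = \sum_i residual b i x * m x i.
Proof.
rewrite /score hamiltonian_local_field -sumrB; apply: eq_bigr => i _.
by rewrite /residual mulrBl [tanh _ * _]mulrC.
Qed.

(** Each m_i is invariant under the flip of x_i, so the right-hand side of
    the flip identity vanishes for g = m_i. *)
Lemma mean_score b : ising_mean b (score b) = 0.
Proof.
rewrite (ising_mean_eq _ (scoreE b)) ising_mean_sum big1// => i _.
rewrite mean_residual /Dflip (@ising_mean_eq _ _ (fun=> 0)).
  by rewrite ising_mean_cst mulr0.
by move=> x; rewrite local_field_flip// subrr mulr0.
Qed.

Lemma mean_hamiltonian b : ising_mean b H =
  \sum_i ising_mean b (fun x => m x i * tanh (p%:R * b * m x i)).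
Proof.
rewrite -ising_mean_sum; set g := fun x => \sum_i _.
have <- : ising_mean b (score b) + ising_mean b g = ising_mean b g.
  by rewrite mean_score add0r.
by rewrite -ising_meanD; apply: ising_mean_eq => x; rewrite /score subrK.
Qed.

(** The energy changes by 2 p x_i m_i, and the remaining sum by at most 3
    times the total change of the local fields. *)
Lemma Dflip_score b i x : 0 < b ->
  `|Dflip i (score b) x| <= 8 * p%:R * rowsum J i.
Proof.
move=> b0; have pb0 : 0 < p%:R * b by rewrite mulr_gt0.
have -> : Dflip i (score b) x = Dflip i H x -
    \sum_j (m x j * tanh (p%:R * b * m x j) -
            m (flip i x) j * tanh (p%:R * b * m (flip i x) j)).
  by rewrite /Dflip /score sumrB; ring.
apply: le_trans (ler_normB _ _) _.
have h1 : `|Dflip i H x| <= 2 * p%:R * rowsum J i.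
  rewrite Dflip_hamiltonian// normrM (normrM (spin R x i)) normr_spin mul1r.
  rewrite (ger0_norm (mulr_ge0 _ _))//.
  by rewrite ler_wpM2l// normr_local_field.
have h2 : `|\sum_j (m x j * tanh (p%:R * b * m x j) -
   m (flip i x) j * tanh (p%:R * b * m (flip i x) j))| <=
   3 * (2 * n.+1%:R * rowsum J i).
  apply: le_trans (ler_norm_sum _ _ _) _.
  apply: le_trans (ler_wpM2l _ (sum_Dflip_local_field Jsym Jdiag i x)) => //.
  rewrite mulr_sumr; apply: ler_sum => j _; exact: mulr_tanh_lipschitz.
apply: le_trans (lerD h1 h2) _.
have : n.+1%:R * rowsum J i <= p%:R * rowsum J i.
  by rewrite ler_wpM2r ?rowsum_ge0// ler_nat.
lra.
Qed.

(** One of the two factors of the square is expanded into residuals; the flip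
    identity transfers the difference to the other factor. *)
Lemma mean_score_sqr b : 0 < b ->
  ising_mean b (fun x => score b x ^+ 2) <= 8 * p%:R * \sum_i rowsum J i ^+ 2.
Proof.
move=> b0; rewrite (@ising_mean_eq _ _
    (fun x => \sum_i residual b i x * (m x i * score b x))); last first.
  move=> x; rewrite expr2 {1}scoreE mulr_suml; apply: eq_bigr => i _.
  by rewrite mulrA.
rewrite ising_mean_sum mulr_sumr; apply: ler_sum => i _.
rewrite mean_residual -[leRHS](ising_mean_cst b) -ising_meanZ.
apply: ising_mean_le => x; apply: le_trans (ler_norm _) _.
have -> : Dflip i (fun x => m x i * score b x) x = m x i * Dflip i (score b) x.
  by rewrite /Dflip local_field_flip// [RHS]mulrBr.
rewrite !normrM ger0_norm//.
have h1 := normr_residual b i x.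
have h2 := normr_local_field J x i.
have h3 := Dflip_score i x b0.
have -> : 8 * p%:R * rowsum J i ^+ 2 =
  2^-1 * (2 * (rowsum J i * (8 * p%:R * rowsum J i))) by field.
by rewrite ler_wpM2l//; apply: ler_pM => //; apply: ler_pM.
Qed.

End Gibbs.

(** * Anti-concentration of the local fields and the mean energy *)

Section AntiConcentration.
Variables (R : realType) (n N : nat).
Local Notation p := n.+2.
Variable J : tensor R p N.
Implicit Types (t u : p.-tuple 'I_N) (i j : 'I_N) (x : cube N) (b A K : R).
Implicit Types (f g : cube N -> R) (l : seq 'I_N).
Hypothesis Jsym : symmetric_tensor J.
Hypothesis Jdiag : zero_diagonals J.

Local Notation H := (hamiltonian J).
Local Notation m := (local_field J).
Local Notation E := (ising_mean J).

(** The factor lost in mean absolute value by one difference along a spin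
    whose row sum is at most A. *)
Definition flip_cost b A : R := 1 + expR (2 * (p%:R * b * A)).

Lemma flip_cost_ge1 b A : 1 <= flip_cost b A.
Proof. by rewrite lerDl expR_ge0. Qed.

Lemma flip_cost_ge0 b A : 0 <= flip_cost b A.
Proof. exact: le_trans (flip_cost_ge1 _ _). Qed.

(** Under the flip of x_i the weights change by the factor
    exp (- 2 p b x_i m_i), where |m_i| <= A. *)
Lemma mean_normr_Dflip b A i f : 0 <= b -> rowsum J i <= A ->
  E b (fun x => `|Dflip i f x|) <= flip_cost b A * E b (fun x => `|f x|).
Proof.
move=> b0 iA.
apply: (@le_trans _ _ (E b (fun x => `|f x| + `|f (flip i x)|))).
  by apply: ising_mean_le => x; exact: ler_normB.
rewrite ising_meanD mulrDl mul1r lerD2l /ising_mean mulr_sumr -(sum_flip i).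
apply: ler_sum => x _; rewrite flipK ising_pmf_flip// -mulrA.
apply: ler_wpM2r; first by rewrite mulr_ge0// ising_pmf_ge0.
rewrite ler_expR -mulrN ler_wpM2l//.
apply: le_trans (ler_norm _) _; rewrite normrN normrM normr_spin mul1r.
rewrite normrM ger0_norm ?mulr_ge0// ler_wpM2l ?mulr_ge0//.
exact: le_trans (normr_local_field _ _ _) _.
Qed.

Lemma mean_normr_foldr_Dflip b A l f : 0 <= b ->
  all (fun i => rowsum J i <= A) l ->
  E b (fun x => `|foldr (@Dflip R N) f l x|) <=
  flip_cost b A ^+ size l * E b (fun x => `|f x|).
Proof.
move=> b0; elim: l => [|i l IH] /=; first by rewrite mul1r.
move=> /andP[iA lA]; apply: le_trans (mean_normr_Dflip _ b0 iA) _.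
by rewrite exprS -mulrA ler_wpM2l ?IH// flip_cost_ge0.
Qed.

(** Differencing along all the indices of t but the first kills every monomial
    of the local field except those supported on these indices. The survivors
    come from permutations of t, so by symmetry they are nonnegative multiples
    of one and the same monomial with coefficient J t, and the multiple is at
    least 1 for t itself. *)
Lemma foldr_Dflip_local_field t x :
  `|J t| <= `|foldr (@Dflip R N) (m ^~ (tnth t ord0)) (behead t) x|.
Proof.
have [->|Jt] := eqVneq (J t) 0; first by rewrite normr0.
have ut := tensor_uniq Jdiag Jt.
have -> : m ^~ (tnth t ord0) = fun y =>
    \sum_(u | tnth u ord0 == tnth t ord0) J u * walsh R (behead u) y.
  by apply/funext => y; rewrite local_fieldE.
rewrite foldr_Dflip_walsh; last first.
  move=> u _ /(tensor_uniq Jdiag); case/tupleP: u => a u.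
  by move=> /andP[].
pose c u : R := \prod_(i <- behead t) ((i \in behead u)%:R * 2).
have c0 u : 0 <= c u by apply: prodr_ge0 => i _; rewrite mulr_ge0.
have ct : 1 <= c t.
  rewrite /c big_seq; apply: (big_ind (fun y : R => 1 <= y)) => //.
    by move=> y z; exact: mulr_ege1.
  by move=> i it; rewrite it mul1r ler1n.
rewrite (eq_bigr (fun u => J t * walsh R (behead t) x * c u)) => [|u hu].
  rewrite -mulr_sumr normrM normrM normr_walsh mulr1 ler_peMr//.
  rewrite ger0_norm ?sumr_ge0// (bigD1 t)//= -[1]addr0.
  by rewrite lerD ?sumr_ge0.
(* an equal number of indices turns the inclusion into a permutation *)
have [/allP tu|/allPn[i it iu]] := boolP (all (mem (behead u)) (behead t)).
  have ub : uniq (behead t).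
    by case/tupleP: t ut {Jt c c0 ct hu tu} => a t /andP[].
  have sz : (size (behead u) <= size (behead t))%N.
    by rewrite !size_behead !size_tuple.
  have [us uE] := uniq_min_size ub tu sz.
  have bu : perm_eq (behead u) (behead t).
    by apply: uniq_perm => //; rewrite -(eq_uniq us uE).
  have pu : perm_eq u t.
    move: hu bu; case/tupleP: t {Jt ut c c0 ct tu ub sz us uE} => a t.
    by case/tupleP: u => a' u; rewrite !tnth0 /= => /eqP ->; rewrite perm_cons.
  by rewrite (Jsym pu) /walsh (perm_big _ bu) /= -/(c u); ring.
have cu : c u = 0.
  rewrite /c (big_rem i)//=; have -> : (i \in behead u) = false by exact/negbTE.
  by rewrite !mul0r.
by rewrite -/(c u) cu !mulr0 mul0r.
Qed.

Lemma tensor_le_mean b A t : 0 <= b -> all (fun i => rowsum J i <= A) t ->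
  `|J t| <= flip_cost b A ^+ n.+1 * E b (fun x => `|m x (tnth t ord0)|).
Proof.
move=> b0 tA; rewrite -[leLHS](ising_mean_cst J b).
apply: (@le_trans _ _ (E b (fun x =>
    `|foldr (@Dflip R N) (m ^~ (tnth t ord0)) (behead t) x|))).
  by apply: ising_mean_le => x; exact: foldr_Dflip_local_field.
have tb : all (fun i => rowsum J i <= A) (behead t).
  by case/tupleP: t tA => a t /= /andP[].
have := mean_normr_foldr_Dflip (m ^~ (tnth t ord0)) b0 tb.
by rewrite size_behead size_tuple.
Qed.

Lemma sum_good_sqr_le b A : 0 <= b -> 0 <= A ->
  \sum_(t : p.-tuple 'I_N | all (fun i => rowsum J i <= A) t) J t ^+ 2 <=
  A * flip_cost b A ^+ n.+1 * \sum_i E b (fun x => `|m x i|).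
Proof.
move=> b0 A0; rewrite big_mkcond sum_tuple_head mulr_sumr.
apply: ler_sum => i _; rewrite -big_mkcondr.
have E0 : 0 <= flip_cost b A ^+ n.+1 * E b (fun x => `|m x i|).
  apply: mulr_ge0; first by rewrite exprn_ge0// flip_cost_ge0.
  by apply: sumr_ge0 => x _; rewrite mulr_ge0// ising_pmf_ge0.
have [iA|iA] := leP (rowsum J i) A; last first.
  rewrite big_pred0 => [|t]; first by rewrite -mulrA mulr_ge0.
  apply/negbTE; rewrite negb_and; case: eqP => //= ti.
  by apply/allPn; exists i; rewrite -?ltNge// -ti mem_tnth.
rewrite -mulrA; apply: le_trans (ler_wpM2r E0 iA).
rewrite /rowsum mulr_suml big_mkcondr/=; apply: ler_sum => t /eqP ti.
case: ifP => tA; last by rewrite mulr_ge0.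
rewrite -real_normK ?num_real// expr2 ler_wpM2l// -ti.
exact: tensor_le_mean.
Qed.

(** Markov's inequality: on a tuple with some row sum above A, the sum of the
    row sums along it, divided by A, is at least 1. Summing over the tuples
    turns this weight into the sum of the squared row sums. *)
Lemma sum_bad_sqr_le A K : 0 < A -> (forall t, `|J t| <= K) ->
  \sum_(t : p.-tuple 'I_N | ~~ all (fun i => rowsum J i <= A) t) J t ^+ 2 <=
  K * p%:R / A * \sum_i rowsum J i ^+ 2.
Proof.
move=> A0 JK.
apply: (@le_trans _ _
    (\sum_t K / A * \sum_(k < p) rowsum J (tnth t k) * `|J t|)).
  rewrite big_mkcond; apply: ler_sum => t _.
  have K0 : 0 <= K by exact: le_trans (JK t).
  have s0 : 0 <= \sum_(k < p) rowsum J (tnth t k) * `|J t|.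
    by apply: sumr_ge0 => k _; rewrite mulr_ge0// rowsum_ge0.
  case: ifPn => [/allPn[_ /tnthP[k ->]]|_]; last first.
    by rewrite mulr_ge0// divr_ge0// ltW.
  rewrite -ltNge => kA; rewrite -real_normK ?num_real// expr2 -mulrA ler_pM//.
  rewrite ler_pdivlMl// (bigD1 k)//= -[leLHS]addr0 lerD//.
    by rewrite ler_wpM2r// ltW.
  by apply: sumr_ge0 => j _; rewrite mulr_ge0// rowsum_ge0.
rewrite -mulr_sumr exchange_big/= (eq_bigr (fun=> \sum_i rowsum J i ^+ 2)).
  rewrite sumr_const card_ord -[_ *+ _]mulr_natl mulrA.
  by rewrite [_ / A * _]mulrAC.
move=> k _; rewrite (partition_big (fun t => tnth t k) xpredT)//=.
apply: eq_bigr => i _.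
have ri : rowsum J i = \sum_(t | tnth t k == i) `|J t|.
  rewrite (sum_position (G := fun t => `|J t|) _ k)//.
  exact: normr_tensor_perm.
rewrite expr2 [X in _ = _ * X]ri mulr_sumr.
by apply: eq_bigr => t /eqP ->.
Qed.

Lemma sum_sqr_le b A K : 0 <= b -> 0 < A -> (forall t, `|J t| <= K) ->
  \sum_t J t ^+ 2 <=
  A * flip_cost b A ^+ n.+1 * \sum_i E b (fun x => `|m x i|) +
  K * p%:R / A * \sum_i rowsum J i ^+ 2.
Proof.
move=> b0 A0 JK.
rewrite (bigID (fun t : p.-tuple 'I_N => all (fun i => rowsum J i <= A) t))/=.
by rewrite lerD ?sum_good_sqr_le ?sum_bad_sqr_le// ltW.
Qed.

Lemma sum_mean_normr_le b e : 0 < b -> 0 < e ->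
  \sum_i E b (fun x => `|m x i|) <= e * N%:R + E b H / tanh (p%:R * b * e).
Proof.
move=> b0 e0; rewrite mean_hamiltonian// mulr_suml mulr_natr.
rewrite -[in X in _ *+ X](card_ord N) -sumr_const -big_split/=.
apply: ler_sum => i _.
rewrite mulrC -ising_meanZ -[X in X + _](ising_mean_cst J b) -ising_meanD.
apply: ising_mean_le => x; rewrite [X in e + X]mulrC.
by apply: normr_le_mulr_tanh => //; rewrite mulr_gt0.
Qed.

End AntiConcentration.

(** * From the score to the estimator *)

Section Estimate.
Variables (R : realType) (n N : nat).
Local Notation p := n.+2.
Variable J : tensor R p N.
Variable x : cube N.
Implicit Types (i : 'I_N) (b h B A c l : R).
Local Notation m := (local_field J x).

(** A lower bound, per spin, for the rate of decrease of the score up to the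
    parameter B, when c bounds the mean of the |m_i| from below and K that of
    the m_i ^+ 2 from above. The cutoff for |m_i| is 2 K / c, beyond which the
    |m_i| contribute at most c N / 2 to their sum. *)
Definition curvature B c K : R :=
  p%:R * expR (- (2 * (p%:R * B * (2 * K / c)))) * (c ^+ 2 / 4).

Lemma curvature_gt0 B c K : 0 < c -> 0 < curvature B c K.
Proof.
by move=> c0; rewrite /curvature !mulr_gt0// ?expR_gt0// exprn_gt0.
Qed.

Lemma score_decrease b h B c K :
  0 <= b -> 0 <= h -> b + h <= B -> 0 < c -> 0 < K ->
  c * N%:R <= \sum_i `|m i| -> \sum_i m i ^+ 2 <= K * N%:R ->
  curvature B c K * h * N%:R <= score J b x - score J (b + h) x.
Proof.
move=> b0 h0 bhB c0 K0 cm mK; pose A := 2 * K / c.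
have A0 : 0 < A by rewrite divr_gt0// mulr_gt0.
have -> : score J b x - score J (b + h) x = \sum_i
    (m i * tanh (p%:R * (b + h) * m i) - m i * tanh (p%:R * b * m i)).
  by rewrite /score sumrB; ring.
(* l = c / 2 maximizes 2 l (c / 2) - l ^+ 2 *)
have c20 : 0 <= c / 2 by rewrite divr_ge0// ltW.
have pb0 : 0 <= p%:R * b by rewrite mulr_ge0.
have pbh : p%:R * b <= p%:R * (b + h) by rewrite ler_wpM2l// lerDl.
have pbhB : p%:R * (b + h) <= p%:R * B by rewrite ler_wpM2l.
apply: le_trans (ler_sum _ (fun i _ =>
  mulr_tanhB_ge (m i) pb0 pbh pbhB A0 c20)).
rewrite -mulr_sumr sumrB -mulr_sumr sumrB sumr_const card_ord -mulr_suml.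
rewrite /curvature -/A.
have -> : p%:R * (b + h) - p%:R * b = p%:R * h by ring.
set e := expR _; pose k := p%:R * e.
have k0 : 0 <= k by rewrite mulr_ge0// expR_ge0.
have -> : e * (p%:R * h) = k * h by rewrite /k; ring.
rewrite -/k.
have -> : k * (c ^+ 2 / 4) * h * N%:R = k * h * (c ^+ 2 / 4 * N%:R) by ring.
apply: ler_wpM2l; first by rewrite mulr_ge0.
have : (\sum_i m i ^+ 2) / A <= c / 2 * N%:R.
  rewrite ler_pdivrMr//; apply: le_trans mK _.
  rewrite /A le_eqVlt; apply/orP; left; apply/eqP; field; exact: lt0r_neq0.
rewrite -[(c / 2) ^+ 2 *+ N]mulr_natr; move: (_ / A) => w hw.
have : c * (c * N%:R) <= c * (\sum_i `|m i|) by rewrite ler_wpM2l// ltW.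
have : c * w <= c * (c / 2 * N%:R) by rewrite ler_wpM2l// ltW.
move: (\sum_i _) => S; nra.
Qed.

Lemma continuous_score : continuous ((fun b => score J b x) : R -> R).
Proof.
move=> b; apply: cvgB; first exact: cvg_cst.
apply: cvg_big => [|i _]; first exact: add_continuous.
apply: cvgM; first exact: cvg_cst.
apply: (@continuous_comp _ _ _ (fun b => p%:R * b * m i) (@tanh R : R -> R));
  last exact: continuous_tanh.
apply: cvgM; last exact: cvg_cst.
by apply: cvgM; [exact: cvg_cst|exact: cvg_id].
Qed.

(** The score is positive on the whole interval from 0 to beta - h and
    negative at beta + h. So it has a zero between beta - h and beta + h, and
    none before; the estimate, being the infimum of its zeros, is there. *)
Lemma mpl_estimate_near beta h c K : 0 < h -> h <= beta -> h <= 1 ->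
  0 < c -> 0 < K ->
  c * N%:R <= \sum_i `|m i| -> \sum_i m i ^+ 2 <= K * N%:R ->
  `|score J beta x| < curvature (beta + 1) c K * h * N%:R ->
  (`|mpl_estimate J x - beta%:E| <= h%:E)%E.
Proof.
move=> h0 hb h1 c0 K0 cm mK; rewrite ltr_norml => /andP[slo shi].
have b0 : 0 <= beta by rewrite (le_trans (ltW h0)).
have bh0 : 0 <= beta - h by rewrite subr_ge0.
have right : score J (beta + h) x < 0.
  have := score_decrease (B := beta + 1) b0 (ltW h0) _ c0 K0 cm mK.
  rewrite lerD2l => /(_ h1); lra.
have left_gt0 : forall b, 0 <= b -> b <= beta - h -> 0 < score J b x.
  move=> b bge ble.
  have hh : 0 <= beta - b by lra.
  have := score_decrease (B := beta + 1) bge hh _ c0 K0 cm mK.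
  rewrite addrC subrK => /(_ _)/wrap[]; first by rewrite lerDl.
  have : curvature (beta + 1) c K * h * N%:R <=
      curvature (beta + 1) c K * (beta - b) * N%:R.
    by rewrite ler_wpM2r// ler_wpM2l ?(ltW (curvature_gt0 _ _ c0))//; lra.
  lra.
have scoreP b : hamiltonian J x = \sum_i m i * tanh (p%:R * b * m i) <->
    score J b x = 0.
  by rewrite /score; split => [->|/eqP]; rewrite ?subrr// subr_eq0 => /eqP.
have [b] : exists2 b, b \in `[beta - h, beta + h] & score J b x = 0.
  apply: (@IVT _ (fun b => score J b x)); first by lra.
    exact/continuous_subspaceT/continuous_score.
  have := left_gt0 _ bh0 (lexx _) => l0.
  by rewrite ge_min le_max (ltW l0) (ltW right) orbT.
rewrite in_itv/= => /andP[blo bhi] sb0.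
have up : (mpl_estimate J x <= (beta + h)%:E)%E.
  apply: (@le_trans _ _ b%:E); last by rewrite lee_fin.
  apply: ereal_inf_lbound; exists b => //; split; last exact/scoreP.
  by rewrite (le_trans bh0).
have lo : ((beta - h)%:E <= mpl_estimate J x)%E.
  apply: le_ereal_inf_tmp => _ [b' [b'0 /scoreP sb'] <-].
  rewrite lee_fin leNgt; apply/negP => /ltW b'h.
  by have := left_gt0 _ b'0 b'h; rewrite sb' ltxx.
move: up lo; case: (mpl_estimate J x) => [r| |] //; rewrite !lee_fin => up lo.
by rewrite ler_distl lo up.
Qed.

End Estimate.

(** * Tail bounds, and what the co-degree matrix controls *)

Section Tails.
Variables (R : realType) (n N : nat).
Local Notation p := n.+2.
Variable J : tensor R p N.
Hypothesis Jsym : symmetric_tensor J.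
Hypothesis Jdiag : zero_diagonals J.
Implicit Types (x : cube N) (b h s : R) (E F G : pred (cube N)).

Local Notation H := (hamiltonian J).

Lemma ising_prob_ge b E F G : (forall x, ~~ F x -> ~~ G x -> E x) ->
  1 - ising_prob J b F - ising_prob J b G <= ising_prob J b E.
Proof.
move=> FGE; rewrite !ising_prob_mean lerBlDr lerBlDr -!ising_meanD.
rewrite -[leLHS](ising_mean_cst J b); apply: ising_mean_le => x.
have := FGE x; case: (F x); case: (G x); case: (E x) => //=; lra.
Qed.

Lemma ising_prob_score_ge b s : 0 < b -> 0 < s ->
  ising_prob J b (fun x => s <= `|score J b x|) <=
  8 * p%:R * (\sum_i rowsum J i ^+ 2) / s ^+ 2.
Proof.
move=> b0 s0; rewrite ler_pdivlMr ?exprn_gt0//.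
apply: le_trans (mean_score_sqr Jsym Jdiag b0).
rewrite ising_prob_mean mulrC -ising_meanZ; apply: ising_mean_le => x.
case: (leP s) => hs; last by rewrite mulr0 sqr_ge0.
by rewrite mulr1 -[leRHS]real_normK ?num_real// lerXn2r ?nnegrE// ltW.
Qed.

Lemma mean_hamiltonian0 : ising_mean J 0 H = 0.
Proof.
rewrite mean_hamiltonian// big1// => i _.
rewrite (@ising_mean_eq _ _ _ _ _ _ (fun=> 0)) ?ising_mean_cst// => x.
by rewrite mulr0 mul0r tanh0 mulr0.
Qed.

(** The weights of the event are at most exp (2 b h) each, whereas the
    partition function at 2 b exceeds the number of configurations by the
    factor exp (b E_b H), by Jensen's inequality used from 0 to b and from b
    to 2 b; the mean of H under the uniform measure vanishes. *)
Lemma ising_prob_hamiltonian_lt b h : 0 <= b ->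
  ising_prob J (b + b) (fun x => H x < h) <=
  expR ((b + b) * h - b * ising_mean J b H).
Proof.
move=> b0; have W0 := gibbs_sum_gt0 J (b + b).
have W2 : expR (b * ising_mean J b H) * gibbs_sum J 0 <= gibbs_sum J (b + b).
  apply: le_trans (gibbs_sum_ge J b b); rewrite ler_wpM2l ?expR_ge0//.
  have := gibbs_sum_ge J 0 b.
  by rewrite mean_hamiltonian0 mulr0 expR0 mul1r add0r.
rewrite /ising_prob (eq_bigr _ (fun x _ => ising_pmfE J (b + b) x)) -mulr_suml.
rewrite ler_pdivrMr// expRD expRN -mulrA.
apply: (@le_trans _ _ (expR ((b + b) * h) * gibbs_sum J 0)).
  rewrite mulr_sumr big_mkcond; apply: ler_sum => x _.
  rewrite mul0r expR0 mulr1; case: ifPn => [/ltW hH|_]; last exact: expR_ge0.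
  by rewrite ler_expR ler_wpM2l// addr_ge0.
by rewrite ler_wpM2l ?expR_ge0// ler_pdivlMl ?expR_gt0.
Qed.

End Tails.

Section CodegreeBounds.
Variables (R : realType) (n N : nat).
Local Notation p := n.+2.

Lemma opnorm_sqr_le (A : 'M[R]_N) (k : R) (v : 'cV[R]_N) :
  (opnorm A <= k%:E)%E -> \sum_i v i 0 ^+ 2 <= 1 ->
  \sum_i (A *m v) i 0 ^+ 2 <= k ^+ 2.
Proof.
move=> Ak v1.
have nv : euclidean_norm v <= 1 by rewrite /euclidean_norm -sqrtr1 ler_wsqrtr.
have : euclidean_norm (A *m v) <= k.
  rewrite -lee_fin; apply: le_trans Ak; apply: ereal_sup_ubound.
  by exists v.
have s0 : 0 <= \sum_i (A *m v) i 0 ^+ 2.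
  by apply: sumr_ge0 => i _; exact: sqr_ge0.
rewrite /euclidean_norm -[X in _ -> X <= _](sqr_sqrtr s0) => h.
by rewrite lerXn2r ?nnegrE ?sqrtr_ge0// (le_trans _ h)// sqrtr_ge0.
Qed.

Variable J : tensor R p N.
Variable k : R.
Hypothesis Jk : (opnorm (codegree_mx J) <= k%:E)%E.

Lemma codegree_mxE i j : n`!%:R * codegree_mx J i j = pairsum J i j.
Proof.
rewrite mxE subSS subSS subn0 mulrA divff ?mul1r; last first.
  by rewrite pnatr_eq0 -lt0n fact_gt0.
by apply: eq_bigl => t; rewrite take2_tuple.
Qed.

(** The co-degree matrix is applied to the constant unit vector. *)
Lemma sum_rowsum_sqr_le : (0 < N)%N ->
  \sum_i rowsum J i ^+ 2 <= (n`!%:R * k) ^+ 2 * N%:R.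
Proof.
move=> N0; have N0' : 0 < N%:R :> R by rewrite ltr0n.
pose v : 'cV[R]_N := const_mx (Num.sqrt N%:R)^-1.
have v2 : (Num.sqrt N%:R)^-1 ^+ 2 = N%:R^-1 :> R.
  by rewrite exprVn sqr_sqrtr// ler0n.
have v1 : \sum_i v i 0 ^+ 2 <= 1.
  rewrite (eq_bigr (fun=> N%:R^-1)) => [|i _]; last by rewrite mxE.
  by rewrite sumr_const card_ord -[_ *+ _]mulr_natl divff ?lt0r_neq0.
have := opnorm_sqr_le Jk v1.
rewrite (eq_bigr (fun i =>
    (rowsum J i ^+ 2) * ((n`!%:R ^+ 2)^-1 / N%:R))) => [|i _].
  rewrite -mulr_suml mulrA ler_pdivrMr// ler_pdivrMr; last first.
    by rewrite exprn_gt0// ltr0n fact_gt0.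
  by rewrite exprMn => /le_trans; apply; rewrite mulrC mulrA.
rewrite mxE -v2 -exprVn -!exprMn -sum_pairsum; congr (_ ^+ 2).
rewrite mulrA !mulr_suml; apply: eq_bigr => j _; rewrite -codegree_mxE.
rewrite [v j 0]mxE; congr (_ * _).
by rewrite mulrC mulKf// pnatr_eq0 -lt0n fact_gt0.
Qed.

(** An entry of J is at most an entry of the pair sums, and an entry of a
    matrix is at most its operator norm. *)
Lemma normr_tensor_le t : 0 <= k -> `|J t| <= n`!%:R * k.
Proof.
move=> k0; apply: le_trans (le_pairsum J t) _.
set i := tnth t ord0; set j := tnth t _.
rewrite -codegree_mxE ler_wpM2l//.
pose v : 'cV[R]_N := delta_mx j 0.
have v1 : \sum_i v i 0 ^+ 2 <= 1.
  rewrite (bigD1 j)//= big1 => [|l lj].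
    by rewrite mxE !eqxx expr1n addr0.
  by rewrite mxE (negbTE lj) expr0n.
have := opnorm_sqr_le Jk v1; rewrite (bigD1 i)//= => h.
have {h} : (codegree_mx J *m v) i 0 ^+ 2 <= k ^+ 2.
  apply: le_trans h; rewrite lerDl; apply: sumr_ge0 => l _; exact: sqr_ge0.
rewrite -colE mxE => h.
have d0 : 0 <= codegree_mx J i j.
  by rewrite mxE mulr_ge0// ?invr_ge0// sumr_ge0.
by rewrite -(ler_pXn2r (_ : 0 < 2)%N) ?nnegrE.
Qed.

End CodegreeBounds.

(** * Consistency *)

(** The constant depends on the bounds only, not on N or J: this uniformity is
    what makes the energy extensive along the whole sequence. *)
Lemma mean_hamiltonian_ge (R : realType) (n : nat) (b c K : R) :
  0 < b -> 0 < c -> 0 < K ->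
  exists2 c1 : R, 0 < c1 & forall (N : nat) (J : tensor R n.+2 N),
    symmetric_tensor J -> zero_diagonals J ->
    c * N%:R <= \sum_(t : n.+2.-tuple 'I_N) J t ^+ 2 ->
    \sum_i rowsum J i ^+ 2 <= K ^+ 2 * N%:R ->
    (forall t, `|J t| <= K) ->
    c1 * N%:R <= ising_mean J b (hamiltonian J).
Proof.
(* the cutoff leaves to the tuples above it at most half of the mass c N *)
move=> b0 c0 K0; pose A := 2 * n.+2%:R * K ^+ 3 / c.
have A0 : 0 < A by rewrite divr_gt0// !mulr_gt0// exprn_gt0.
pose L := A * flip_cost n b A ^+ n.+1.
have L0 : 0 < L.
  apply: mulr_gt0 => //; apply: exprn_gt0.
  exact: lt_le_trans (flip_cost_ge1 _ _ _).
(* half of the lower bound c / (2 L) for the mean of the |m_i| *)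
pose e := c / (4 * L); have e0 : 0 < e by rewrite divr_gt0// mulr_gt0.
pose tau := tanh (n.+2%:R * b * e).
have tau0 : 0 < tau.
  apply: tanh_gt0; apply: mulr_gt0 => //; exact: mulr_gt0.
exists (tau * e); first exact: mulr_gt0.
move=> N J Jsym Jdiag cJ RK JK.
have h1 := sum_sqr_le Jsym Jdiag (ltW b0) A0 JK.
have h2 := sum_mean_normr_le Jsym Jdiag b0 e0.
rewrite -/L in h1; rewrite -/tau in h2.
have h3 : K * n.+2%:R / A * (\sum_i rowsum J i ^+ 2) <= c / 2 * N%:R.
  have -> : c / 2 * N%:R = K * n.+2%:R / A * (K ^+ 2 * N%:R).
    by rewrite /A; field; rewrite ?pnatr_eq0 !lt0r_neq0.
  by rewrite ler_wpM2l// divr_ge0 ?(ltW A0)// mulr_ge0// ltW.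
move: h1 h2 h3.
set S := \sum_i ising_mean _ _ _; set T := \sum_i rowsum J i ^+ 2.
set M := ising_mean _ _ _ => h1 h2 h3.
have h4 : c / 2 * N%:R <= L * S by lra.
have h5 : 2 * e * N%:R <= S.
  rewrite -(ler_pM2l L0); apply: le_trans h4; rewrite /e le_eqVlt.
  by apply/orP; left; apply/eqP; field; rewrite lt0r_neq0.
have h6 : e * N%:R <= M / tau by lra.
by rewrite -mulrA mulrC -ler_pdivlMr.
Qed.

Theorem corollary2p6 (R : realType) (p : nat) (J : forall N : nat, tensor R p N)
    (hp : (2 <= p)%N)
    (Jsym : forall N : nat, (1 <= N)%N -> symmetric_tensor (J N))
    (Jdiag : forall N : nat, (1 <= N)%N -> zero_diagonals (J N))
    (codeg_bounded :
      (ereal_sup [set opnorm (codegree_mx (J N)) | N in [set N : nat | (1 <= N)%N]]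
        < +oo)%E)
    (liminf_pos :
      (0 < limn_einf (fun N : nat =>
        (N%:R^-1 * \sum_(t : p.-tuple 'I_N | sorted ltn (map val t)) (J N t) ^+ 2)%:E))%E) :
  forall beta : R, 0 < beta -> mpl_sqrtN_consistent J beta.
Proof.
case: p hp J Jsym Jdiag codeg_bounded liminf_pos => [|[|n]]// _ J Jsym Jdiag.
move=> codeg_bounded liminf_pos beta beta0 delta delta0.
have [k k0 Jk] : exists2 k : R, 0 < k &
    forall N, (1 <= N)%N -> (opnorm (codegree_mx (J N)) <= k%:E)%E.
  move: codeg_bounded; set s := ereal_sup _ => s_fin.
  have Js N : (1 <= N)%N -> (opnorm (codegree_mx (J N)) <= s)%E.
    by move=> N1; apply: ereal_sup_ubound; exists N.
  exists (`|fine s| + 1) => [|N N1]; first by rewrite ltr_wpDl.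
  apply: le_trans (Js _ N1) _; move: s_fin; case: s {Js} => [s| |]//= _.
    by rewrite lee_fin (le_trans (ler_norm _))// lerDl.
  by rewrite leNye.
have [c c0 Jc] : exists2 c : R, 0 < c & \forall N \near \oo,
    c * N%:R <= \sum_(t : n.+2.-tuple 'I_N) J N t ^+ 2.
  move: liminf_pos; set u := fun N : nat => _.
  rewrite limn_einf_lim (cvg_lim _ (cvg_einfs_sup (u := u)))//.
  move=> /ereal_sup_gt[_ [N0 _ <-]] u0.
  have [c c0 cu] : exists2 c : R, 0 < c & (c%:E <= einfs u N0)%E.
    move: u0; case: (einfs u N0) => [r r0| _|//]; first by exists r.
    by exists 1 => //; rewrite leey.
  exists c => //; near=> N.
  have N0' : 0 < N%:R :> R by rewrite ltr0n; near: N; exact: nbhs_infty_gt.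
  have : (c%:E <= u N)%E.
    apply: le_trans cu _; apply: ereal_inf_lbound; exists N => //=.
    by near: N; exact: nbhs_infty_ge.
  rewrite lee_fin -ler_pdivrMl ?invr_gt0// invrK mulrC => /le_trans; apply.
  rewrite big_mkcond; apply: ler_sum => t _; case: ifP => // _.
  exact: sqr_ge0.
pose K := n`!%:R * k.
have K0 : 0 < K by rewrite mulr_gt0// ltr0n fact_gt0.
have b0 : 0 < beta / 2 by rewrite divr_gt0.
have [c1 c10 Hc1] := mean_hamiltonian_ge n b0 c0 K0.
pose c2 := c1 / 4; have c20 : 0 < c2 by rewrite divr_gt0.
have K20 : 0 < K ^+ 2 by rewrite exprn_gt0.
pose q := 8 * n.+2%:R * K ^+ 2.
have q0 : 0 < q by rewrite !mulr_gt0.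
(* s >= 1 gives s ^+ 2 >= s, which exceeds q divided by delta / 2 *)
pose s := 1 + 2 * q / delta.
have s1 : 1 <= s by rewrite lerDl divr_ge0 ?ltW// mulr_gt0.
have s0 : 0 < s by exact: lt_le_trans s1.
pose kappa := curvature n (beta + 1) c2 (K ^+ 2).
have kappa0 : 0 < kappa by exact: curvature_gt0.
(* likely score bound s sqrt N divided by its rate of decrease kappa N *)
pose M := s / kappa; have M0 : 0 < M by exact: divr_gt0.
exists M; split => //; near=> N.
have N1 : (1 <= N)%N by near: N; exact: nbhs_infty_ge.
have N0 : 0 < N%:R :> R by rewrite ltr0n.
pose rN : R := Num.sqrt N%:R.
have rN0 : 0 < rN by rewrite sqrtr_gt0.
have rN2 : rN ^+ 2 = N%:R by rewrite sqr_sqrtr// ltW.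
have sN := Jsym _ N1; have dN := Jdiag _ N1.
have RK : \sum_i rowsum (J N) i ^+ 2 <= K ^+ 2 * N%:R.
  exact: sum_rowsum_sqr_le (Jk _ N1) N1.
have JK t : `|J N t| <= K by exact: normr_tensor_le (Jk _ N1) _ (ltW k0).
have JcN : c * N%:R <= \sum_(t : n.+2.-tuple 'I_N) J N t ^+ 2.
  by near: N; exact: Jc.
have EH := Hc1 N (J N) sN dN JcN RK JK.
pose h := M / rN; have h0 : 0 < h by exact: divr_gt0.
have hle (r : R) : 0 < r -> (M / r) ^+ 2 <= N%:R -> h <= r.
  move=> r0 hr; have Mr0 : 0 <= M / r by exact: ltW (divr_gt0 M0 r0).
  rewrite /h ler_pdivrMr// mulrC -ler_pdivrMr//.
  by rewrite -(ler_pXn2r (_ : 0 < 2)%N) ?nnegrE// ?rN2// ltW.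
have hbeta : h <= beta by apply: hle => //; near: N; exact: nbhs_infty_ger.
have h1 : h <= 1 by apply: hle => //; near: N; exact: nbhs_infty_ger.
have P1 : ising_prob (J N) beta (fun x => hamiltonian (J N) x < c2 * N%:R) <
    delta / 2.
  have := ising_prob_hamiltonian_lt sN dN (c2 * N%:R) (ltW b0).
  rewrite -splitr => /le_lt_trans; apply.
  pose y := beta * c2 * N%:R.
  have y0 : 0 < y by rewrite !mulr_gt0.
  apply: (@le_lt_trans _ _ (expR (- y))).
    rewrite ler_expR /y.
    have : beta / 2 * (c1 * N%:R) <=
        beta / 2 * ising_mean (J N) (beta / 2) (hamiltonian (J N)).
      by rewrite ler_wpM2l// ltW.
    rewrite /c2; lra.
  rewrite expRN invf_plt ?posrE ?expR_gt0 ?divr_gt0//.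
  apply: (@lt_le_trans _ _ (1 + y)); last exact: expR_ge1Dx.
  rewrite ltr_pwDl// /y [leRHS]mulrC -ler_pdivrMr ?mulr_gt0//.
  by near: N; exact: nbhs_infty_ger.
have P2 : ising_prob (J N) beta
    (fun x => s * rN <= `|score (J N) beta x|) <= delta / 2.
  apply: le_trans (ising_prob_score_ge sN dN beta0 (mulr_gt0 s0 rN0)) _.
  rewrite ler_pdivrMr ?exprn_gt0 ?mulr_gt0// exprMn rN2.
  apply: (@le_trans _ _ (q * N%:R)).
    by rewrite /q -[leRHS]mulrA ler_wpM2l.
  rewrite mulrA ler_wpM2r ?(ltW N0)//.
  have : delta / 2 * s <= delta / 2 * s ^+ 2.
    by rewrite ler_wpM2l ?divr_ge0 ?(ltW delta0)// expr2 ler_peMr// ltW.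
  apply: le_trans.
  have -> : delta / 2 * s = delta / 2 + q.
    by rewrite /s; field; exact: lt0r_neq0.
  by rewrite lerDr divr_ge0// ltW.
have := ising_prob_ge (J N) beta
  (E := fun x => ((Num.sqrt N%:R)%:E *
     `|mpl_estimate (J N) x - beta%:E| <= M%:E)%E)
  (F := fun x => hamiltonian (J N) x < c2 * N%:R)
  (G := fun x => s * rN <= `|score (J N) beta x|).
move=> /(_ _)/wrap[|PE]; last by apply: lt_le_trans PE; lra.
move=> x; rewrite -leNgt -ltNge => Hx Sx.
have near_beta : (`|mpl_estimate (J N) x - beta%:E| <= h%:E)%E.
  apply: (mpl_estimate_near h0 hbeta h1 c20 K20).
  - apply: le_trans Hx _; rewrite hamiltonian_local_field.
    apply: ler_sum => i _; apply: le_trans (ler_norm _) _.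
    by rewrite normrM normr_spin mul1r.
  - apply: le_trans RK; apply: ler_sum => i _.
    rewrite -real_normK ?num_real// lerXn2r ?nnegrE ?rowsum_ge0//.
    exact: normr_local_field.
  - apply: lt_le_trans Sx _; rewrite -/kappa /h /M -rN2 le_eqVlt.
    by apply/orP; left; apply/eqP; field; rewrite !lt0r_neq0.
have -> : M%:E = (rN%:E * h%:E)%E.
  by rewrite -EFinM /h mulrC divfK// lt0r_neq0.
by rewrite lee_pmul2l.
Unshelve. all: by end_near. Qed.
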